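(* Let $a$ be a positive integer. For every positive integer $C$ there exist integers $L,N_0\ge 1$ with the following property. For every congruence class $c \bmod L$ there exist, for each length $l\ge 1$, a family (indexed by $i$) of integers $m_{i,l},p_{i,l},k_{i,l},r_{i,l}$ and binary sequences $s_{i,l}$ of length $l$, depending only on $c$ (and not on $N$), such that $m_{i,l}=k_{i,l}$ if and only if $l=1$, and such that for every integer $N\ge N_0$ with $N>a$ and $N\equiv c \pmod L$, $$U(a,N)\cap[1,CN]=\Big(\bigcup_{l\ge 1}\ \bigsqcup_{i} A\big(m_{i,l}N+p_{i,l},\,k_{i,l}N+r_{i,l},\,s_{i,l}\big)\Big)\cap[1,CN],$$ where for each fixed $l$ the union over $i$ is disjoint.
   Context: For positive integers $a<b$, the Ulam sequence $U(a,b)$ is the increasing sequence whose first two terms are $a,b$ and in which each subsequent term is the smallest integer larger than the previous term that can be written as $u+v$ with $u<v$ earlier terms in exactly one way; we identify it with its set of terms. For integers $m_1,m_2$ and a binary sequence $s=(s_0,\dots,s_{l-1})$ of length $l\ge1$, define $A(m_1,m_2,s)=\{n\in\mathbb{Z}_{\ge0} : m_1\le n\le m_2,\ s_{(n-m_1)\bmod l}=1\}$. *)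

(* Defs.v *)
From mathcomp Require Import all_boot all_order all_algebra.
Set Implicit Arguments.
Unset Strict Implicit.
Unset Printing Implicit Defensive.

Definition nreps (t : seq nat) (n : nat) : nat :=
  count (fun uv => (uv.1 < uv.2) && (uv.1 + uv.2 == n))
        [seq (u, v) | u <- t, v <- t].

(* For t increasing with last term x, every sum u + v with u < v in t is
   smaller than 2 * x, so searching x.+1, ..., 2 * x loses no candidate; the
   default value 0 is never reached on Ulam sequences (see ulam_nextP). *)
Definition ulam_next (t : seq nat) : nat :=
  let x := last 0 t in head 0 [seq n <- iota x.+1 x | nreps t n == 1].

Definition ulam_terms (a b n : nat) : seq nat :=
  iter n (fun t => rcons t (ulam_next t)) [:: a; b].

Definition ulam (a b n : nat) : nat := nth 0 (ulam_terms a b n) n.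

Definition in_ulam (a b x : nat) : Prop := exists n, ulam a b n = x.

Definition periodicA (m1 m2 : int) (l : nat) (s : l.-tuple bool) : pred nat :=
  fun n => [&& (m1 <= n%:Z)%R, (n%:Z <= m2)%R &
               nth false s `|((n%:Z - m1)%R %% l%:Z)%Z|%N].

Lemma nreps_last2 t x y : sorted ltn (rcons (rcons t x) y) ->
  nreps (rcons (rcons t x) y) (x + y) = 1.
Proof.
set w := rcons _ _ => sw.
have uw : uniq w by apply: (sorted_uniq ltn_trans ltnn sw).
have xy : x < y.
  move: sw; rewrite /w -!cats1 -catA (sorted_pairwise ltn_trans).
  by rewrite pairwise_cat /= => /and3P[_ _ /andP[/andP[]]].
have ley u : u \in w -> (u == y) || (u <= x).
  rewrite /w !(mem_rcons, inE) => /or3P[->//|/eqP->|ut]; first by rewrite leqnn orbT.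
  move: sw; rewrite /w -!cats1 -catA (sorted_pairwise ltn_trans).
  rewrite pairwise_cat => /andP[/allrelP/(_ u x ut)].
  by rewrite inE eqxx => /(_ isT)/ltnW-> _; rewrite orbT.
have up : uniq [seq (u, v) | u <- w, v <- w].
  by apply: allpairs_uniq => // -[? ?] [? ?].
transitivity (count_mem (x, y) [seq (u, v) | u <- w, v <- w]); last first.
  rewrite count_uniq_mem //; apply/eqP; rewrite eqb1; apply/allpairsP.
  by exists (x, y); rewrite /w !(mem_rcons, inE) !eqxx ?orbT.
apply: eq_in_count => -[u v] /allpairsP[[u' v'] /= [/ley hu /ley hv [-> ->]]].
apply/andP/eqP => [[lt /eqP e]|[-> ->]]; last by rewrite xy eqxx.
case/orP: hv hu => [/eqP ev|hv] /orP[/eqP eu|hu].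
- by rewrite ev eu ltnn in lt.
- by rewrite ev in e *; move/addIn: e => ->.
- by have := leq_trans lt hv; rewrite eu ltnNge (ltnW xy).
- have : u' + v' < x + y by rewrite -addnS leq_add // (leq_ltn_trans hv).
  by rewrite e ltnn.
Qed.

Lemma ulam_nextP t x y : 0 < x -> sorted ltn (rcons (rcons t x) y) ->
  let w := rcons (rcons t x) y in
  [/\ y < ulam_next w, nreps w (ulam_next w) = 1 &
      forall n, y < n -> nreps w n = 1 -> ulam_next w <= n].
Proof.
move=> x0 sw w; have r1 := nreps_last2 sw.
have xy : x < y.
  move: sw; rewrite -!cats1 -catA (sorted_pairwise ltn_trans).
  by rewrite pairwise_cat /= => /and3P[_ _ /andP[/andP[]]].
rewrite /ulam_next last_rcons; set f := [seq _ <- _ | _].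
have inf n : (n \in f) = [&& nreps w n == 1, y < n & n < y.+1 + y].
  by rewrite mem_filter mem_iota.
have sf : sorted ltn f by apply/sorted_filter/iota_ltn_sorted/ltn_trans.
have xyf : x + y \in f.
  by rewrite inf r1 eqxx -add1n leq_add2r x0 ltn_add2r leqW.
have hdf : head 0 f \in f by case: (f) xyf => //= z g _; rewrite mem_head.
have hmin n : n \in f -> head 0 f <= n.
  case: (f) sf => //= z g; rewrite (path_sortedE ltn_trans) => /andP[/allP h _].
  by rewrite inE => /orP[/eqP->//|/h/ltnW].
move: (hdf); rewrite inf => /and3P[/eqP h1 h2 h3]; split=> // n yn rn.
case: (ltnP n (y.+1 + y)) => hn; first by apply: hmin; rewrite inf rn eqxx yn.
by apply: ltnW; apply: leq_trans hn.
Qed.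

Lemma ulam_terms_inv a b n : 0 < a < b ->
  exists t x y, [/\ ulam_terms a b n = rcons (rcons t x) y, 0 < x &
                    sorted ltn (rcons (rcons t x) y)].
Proof.
case/andP=> a0 ab; elim: n => [|n [t [x [y [e x0 st]]]]].
  by exists [::], a, b; rewrite /= ab.
have [lt _ _] := ulam_nextP x0 st.
exists (rcons t x), y, (ulam_next (rcons (rcons t x) y)); split.
- by rewrite /ulam_terms iterS -/(ulam_terms a b n) e.
- move: st; rewrite -!cats1 -catA (sorted_pairwise ltn_trans).
  by rewrite pairwise_cat /= => /and3P[_ _ /andP[/andP[/(leq_trans _)-> //]]].
- move: st lt; case: (t) => [|z g] /=.
    by move=> /andP[-> _] ->.
  by rewrite !rcons_path !last_rcons /= => /andP[-> ->] ->.
Qed.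

(* Main.v *)
(** For x >= N > 2 a, the only representations of x using the term a are
    (a, x - a), so x is a term of U(a, N) iff [x - a in U] + r(x) = 1, where r(x)
    counts the representations of x by two terms >= N and only involves terms
    <= x - N. Call f_N(x) tame on [0, K N) if, for N large, it depends only on the
    residues of x and N modulo some P and on the position of x relative to the
    multiples of N, distances being truncated at some B.
    - If U is tame on [0, K N), then min(r, 2) is tame on [0, (K + 1) N): if x and
      x' have the same truncated type, then a splitting x = u + v is matched by a
      splitting x' = u' + v' with the same types (a back-and-forth argument), two
      distinct splittings being matched by distinct ones.
    - On the block [K N, (K + 1) N) the recursion for U is then driven by a periodic
      input away from the ends of the block. As F o F o F = F for each F : bool -> bool,
      U is periodic there, with doubled period, after one period of the input.
    Tameness of U on [0, (C + 1) N) is the desired description: bounded neighbourhoods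
    of the multiples of N give the pieces with l = 1, and the rest of each block
    gives one piece with l = P. *)
Require Import Defs.
From mathcomp Require Import all_boot all_order all_algebra.
From mathcomp Require Import zify ring.
Set Implicit Arguments.
Unset Strict Implicit.
Unset Printing Implicit Defensive.
Import Order.TTheory GRing.Theory Num.Theory.
Local Open Scope ring_scope.

(** * Types of positions relative to the multiples of [N], and tameness *)

(** Equality of the two distances once clipped to [[-B - 1, B + 1]]. *)
Definition near (B : nat) (d d' : int) : Prop :=
  d = d' \/ (B%:Z < d /\ B%:Z < d') \/ (d < - B%:Z /\ d' < - B%:Z).

Definition modeq (P : nat) (x y : int) : Prop := (P %| x - y)%Z.

Definition sim (B P : nat) (N N' x x' : int) : Prop :=
  [/\ modeq P N N', modeq P x x' &
      forall k : int, near B (x - k * N) (x' - k * N')].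

(** Two scales [N] and [N'] are compared, which makes the values independent of [N] within a residue
    class. The type [T] covers both membership and representation counts. *)
Definition tame (T : Type) (K B P N0 : nat) (f : nat -> nat -> T) : Prop :=
  forall N N' x x' : nat, (N0 <= N)%N -> (N0 <= N')%N ->
  sim B P N N' x x' -> (x < K * N)%N -> f N x = f N' x'.

Lemma modeq_mull m P x y : modeq (m * P) x y -> modeq P x y.
Proof. by apply: dvdz_trans; rewrite PoszM; exact: dvdz_mull. Qed.

Lemma near_sym B d d' : near B d d' -> near B d' d.
Proof. rewrite /near; lia. Qed.

Lemma sim_sym B P N N' x x' : sim B P N N' x x' -> sim B P N' N x' x.
Proof.
case=> hN hx h; split; [by rewrite /modeq -opprB rpredN..|] => k.
exact: near_sym.
Qed.

Lemma sim_mono B B' P P' N N' x x' : (B <= B')%N -> (P %| P')%N ->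
  sim B' P' N N' x x' -> sim B P N N' x x'.
Proof.
move=> hB hP [hN hx h]; split.
- exact: dvdz_trans hN.
- exact: dvdz_trans hx.
- by move=> k; have := h k; rewrite /near; lia.
Qed.

Lemma tame_mono T K B B' P P' N0 N0' (f : nat -> nat -> T) :
  (B <= B')%N -> (P %| P')%N -> (N0 <= N0')%N ->
  tame K B P N0 f -> tame K B' P' N0' f.
Proof.
move=> hB hP hN0 hf N N' x x' hN hN' hs; apply: hf; try lia.
exact: sim_mono hs.
Qed.

(** At most the multiple [K * N] lies within [B], and the offset [e] from it is the same on both
    sides. *)
Lemma sim_edge (B P : nat) (N N' : nat) (K e : int) : modeq P N N' ->
  `|e| + B%:Z < N%:Z -> `|e| + B%:Z < N'%:Z ->
  sim B P N N' (K * N + e) (K * N' + e).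
Proof.
move=> hP h h'; split=> //.
  rewrite /modeq; have -> : K * N + e - (K * N' + e) = K * (N%:Z - N'%:Z) by ring.
  exact: dvdz_mull.
move=> k; rewrite /near.
have -> : K * N + e - k * N = (K - k) * N + e by ring.
have -> : K * N' + e - k * N' = (K - k) * N' + e by ring.
have [q0|[q1|q1]] : K - k = 0 \/ 1 <= K - k \/ K - k <= -1 by lia.
- by left; rewrite q0 !mul0r.
- by right; left; split; nia.
- by right; right; split; nia.
Qed.

(** Every multiple of [N] is further than [B] away, so only the residue of the offset matters. *)
Lemma sim_bulk (B P : nat) (N N' : nat) (K j j' : int) : modeq P N N' ->
  modeq P j j' -> B%:Z < j -> B%:Z < j' ->
  j + B%:Z < N%:Z -> j' + B%:Z < N'%:Z ->
  sim B P N N' (K * N + j) (K * N' + j').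
Proof.
move=> hP hj h1 h1' h2 h2'; split=> //.
  rewrite /modeq; have -> : K * N + j - (K * N' + j') = K * (N%:Z - N'%:Z) + (j - j') by ring.
  by apply: rpredD => //; exact: dvdz_mull.
move=> k; rewrite /near.
have -> : K * N + j - k * N = (K - k) * N + j by ring.
have -> : K * N' + j' - k * N' = (K - k) * N' + j' by ring.
have [q1|q1] : 0 <= K - k \/ K - k <= -1 by lia.
- by right; left; split; nia.
- by right; right; split; nia.
Qed.

(** * Back-and-forth matching of splittings *)

(** For odd [g] this is, up to sign, a distance from [x] to a multiple of [N]; for [g = 2] or [-2],
    up to sign, twice such a distance; for [g = 0] it is zero or beyond [B]. *)
Lemma sim_comb (B P : nat) (N N' x x' : int) (g k : int) :
  B%:Z < N -> B%:Z < N' -> sim B P N N' x x' -> -2 <= g <= 2 ->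
  near B (g * x + 2 * k * N) (g * x' + 2 * k * N').
Proof.
move=> hN hN' [_ _ h] hg.
have [->|[->|[->|[->|->]]]] : g = 0 \/ g = 1 \/ g = -1 \/ g = 2 \/ g = -2 by lia.
- have [->|[q|q]] : k = 0 \/ 1 <= k \/ k <= -1 by lia.
  + by left; ring.
  + by right; left; split; nia.
  + by right; right; split; nia.
- have := h (- 2 * k); rewrite /near !mul1r !mulNr !opprK; lia.
- have := h (2 * k); rewrite /near; lia.
- have := h (- k); rewrite /near !mulNr !opprK -!mulrA; lia.
- have := h k; rewrite /near -!mulrA; lia.
Qed.

(** The doubles of a class modulo [P] are spaced by [2 * P], so a half-open window of that length
    contains one. *)
Lemma ex_congr_gt (P : nat) (m u : int) : (0 < P)%N ->
  exists u', [/\ m < 2 * u', 2 * u' <= m + 2 * P%:Z & (P %| u - u')%Z].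
Proof.
move=> hP.
pose t := ((u - (m %/ 2)%Z - 1) %% P)%Z.
have t0 : 0 <= t by apply: modz_ge0; lia.
have t1 : t < P by apply: ltz_pmod; lia.
exists ((m %/ 2)%Z + 1 + t); split; try lia.
have e := divz_eq (u - (m %/ 2)%Z - 1) P.
apply/dvdzP; exists ((u - (m %/ 2)%Z - 1) %/ P)%Z.
rewrite -/t in e; lia.
Qed.

(** The splitting [u + (x - u)] looks like [u' + (x' - u')]; the last clause preserves which summand
    is smaller. *)
Definition rsim (B P : nat) (N N' x x' u u' : int) : Prop :=
  [/\ sim B P N N' u u', sim B P N N' (x - u) (x' - u') &
      near B (2 * u - x) (2 * u' - x')].

Lemma floor_threshold (N y : int) : 0 < N ->
  exists k, 2 * k * N <= y /\ y < 2 * (k + 1) * N.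
Proof.
move=> hN; exists (y %/ (2 * N))%Z.
have e := divz_eq y (2 * N).
have h0 : 0 <= (y %% (2 * N))%Z by apply: modz_ge0; lia.
have h1 : (y %% (2 * N))%Z < 2 * N by apply: ltz_pmod; lia.
set q := (y %/ _)%Z in e *.
have -> : 2 * q * N = q * (2 * N) by ring.
have -> : 2 * (q + 1) * N = q * (2 * N) + 2 * N by ring.
lia.
Qed.

(* Matching u with u' amounts to placing 2 u' relative to the thresholds
   g x' + 2 k N' (g = 0, 1, 2) as 2 u is placed relative to g x + 2 k N: g = 0 and
   g = 2 control the types of u and x - u, and g = 1 the sign of 2 u - x. *)
Section BackForth.

Variables (B P D E : nat) (N N' x x' : int).
Hypothesis P_gt0 : (0 < P)%N.
Hypotheses (D_def : D = (2 * B + 2 * P)%N) (E_def : E = (4 * D)%N).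
Hypotheses (hN : E%:Z < N) (hN' : E%:Z < N').
Hypothesis hs : sim E (2 * P) N N' x x'.

(** If [2 u] is within [D] of a threshold, [2 u'] is put at the same offset [e] from the
    corresponding threshold. *)
Lemma back_forth_near (u g k : int) : 0 <= g <= 2 ->
  `|2 * u - (g * x + 2 * k * N)| <= D%:Z -> exists u', rsim B P N N' x x' u u'.
Proof.
move=> hg he.
have comb h j : -2 <= h <= 2 -> near E (h * x + 2 * j * N) (h * x' + 2 * j * N').
  exact: sim_comb hs.
have [/dvdzP[n en] /dvdzP[y ey] _] := hs.
set e := 2 * u - _ in he.
have eu : 2 * u = g * x + 2 * k * N + e by rewrite /e; ring.
(* Half the difference of the two thresholds: congruence modulo [2 * P] makes it a multiple of
   [P]. *)
pose w := g * y * P%:Z + 2 * k * n * P%:Z.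
have eu' : 2 * (u - w) = g * x' + 2 * k * N' + e.
  have -> : x' = x - y * (2 * P)%N by rewrite -ey; ring.
  have -> : N' = N - n * (2 * P)%N by rewrite -en; ring.
  by rewrite [LHS]mulrBr eu /w PoszM; ring.
exists (u - w).
have dw : (P %| w)%Z.
  by apply/dvdzP; exists (g * y + 2 * k * n); rewrite /w; ring.
have dN : modeq P N N'.
  by apply/dvdzP; exists (n * 2); rewrite en PoszM; ring.
have dx : modeq P x x'.
  by apply/dvdzP; exists (y * 2); rewrite ey PoszM; ring.
split; first split=> //.
- by rewrite /modeq; have -> : u - (u - w) = w by ring.
- move=> j; have := comb g (k - j) ltac:(lia).
  have -> : g * x + 2 * (k - j) * N = 2 * (u - j * N) - e.
    by rewrite (mulrBr 2 u) eu; ring.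
  have -> : g * x' + 2 * (k - j) * N' = 2 * (u - w - j * N') - e.
    by rewrite (mulrBr 2 (u - w)) eu'; ring.
  rewrite /near; lia.
- split=> //.
    rewrite /modeq; have -> : x - u - (x' - (u - w)) = (x - x') - w by ring.
    by apply: rpredB.
  move=> j; have := comb (2 - g) (- k - j) ltac:(lia).
  have -> : (2 - g) * x + 2 * (- k - j) * N = 2 * (x - u - j * N) + e.
    have -> : 2 * (x - u - j * N) = 2 * x - 2 * u - 2 * j * N by ring.
    by rewrite eu; ring.
  have -> : (2 - g) * x' + 2 * (- k - j) * N' = 2 * (x' - (u - w) - j * N') + e.
    have -> : 2 * (x' - (u - w) - j * N') = 2 * x' - 2 * (u - w) - 2 * j * N'.
      by ring.
    by rewrite eu'; ring.
  rewrite /near; lia.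
- have := comb (g - 1) k ltac:(lia).
  have -> : (g - 1) * x + 2 * k * N = 2 * u - x - e by rewrite eu; ring.
  have -> : (g - 1) * x' + 2 * k * N' = 2 * (u - w) - x' - e by rewrite eu'; ring.
  rewrite /near; lia.
Qed.

(** If [2 u] is far from all thresholds, it lies between consecutive ones in each of the three
    families. The corresponding three intervals for [x'] have a common part wide enough to contain
    [2 u'] for some [u'] in the class of [u]. *)
Lemma back_forth (u : int) : exists u', rsim B P N N' x x' u u'.
Proof.
have comb h j : -2 <= h <= 2 -> near E (h * x + 2 * j * N) (h * x' + 2 * j * N').
  exact: sim_comb hs.
have fl (g : int) : exists k : int, (0 <= g <= 2 -> exists u', rsim B P N N' x x' u u') \/
    (g * x + 2 * k * N < 2 * u - D%:Z /\
     2 * u + D%:Z < g * x + 2 * (k + 1) * N).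
  have [k [k1 k2]] := @floor_threshold N (2 * u - g * x) ltac:(lia).
  exists k.
  have [h|h] : `|2 * u - (g * x + 2 * k * N)| <= D%:Z \/
     D%:Z < 2 * u - (g * x + 2 * k * N) by lia.
    by left=> hg; exact: back_forth_near h.
  have [h2|h2] : `|2 * u - (g * x + 2 * (k + 1) * N)| <= D%:Z \/
     2 * u - (g * x + 2 * (k + 1) * N) < - D%:Z by lia.
    by left=> hg; exact: back_forth_near h2.
  right; lia.
have [k0 [//|[l0 h0]]] := fl 0; first exact.
have [k1 [//|[l1 h1]]] := fl 1; first exact.
have [k2 [//|[l2 h2]]] := fl 2; first exact.
have [l' El'] : exists l' : int -> int -> int,
    forall g k, l' g k = g * x' + 2 * k * N' by eexists=> g k; reflexivity.
have [h' Eh'] : exists h' : int -> int -> int,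
    forall g k, h' g k = g * x' + 2 * (k + 1) * N' by eexists=> g k; reflexivity.
(* Both thresholds are more than [D] from [2 u], hence more than [2 D] apart; this passes to [x']
   because [E] exceeds [2 D]. *)
have gap (g k g' k' : int) : -2 <= g' - g <= 2 ->
    g * x + 2 * k * N < 2 * u - D%:Z ->
    2 * u + D%:Z < g' * x + 2 * (k' + 1) * N ->
    l' g k + 2 * D%:Z < h' g' k'.
  rewrite El' Eh' => hg a1 a2; have := comb (g' - g) (k' + 1 - k) hg.
  have -> : (g' - g) * x + 2 * (k' + 1 - k) * N =
     g' * x + 2 * (k' + 1) * N - (g * x + 2 * k * N) by ring.
  have -> : (g' - g) * x' + 2 * (k' + 1 - k) * N' =
     g' * x' + 2 * (k' + 1) * N' - (g * x' + 2 * k * N') by ring.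
  rewrite /near; lia.
have g00 := gap 0 k0 0 k0 isT l0 h0; have g01 := gap 0 k0 1 k1 isT l0 h1.
have g02 := gap 0 k0 2 k2 isT l0 h2; have g10 := gap 1 k1 0 k0 isT l1 h0.
have g11 := gap 1 k1 1 k1 isT l1 h1; have g12 := gap 1 k1 2 k2 isT l1 h2.
have g20 := gap 2 k2 0 k0 isT l2 h0; have g21 := gap 2 k2 1 k1 isT l2 h1.
have g22 := gap 2 k2 2 k2 isT l2 h2.
have [M [M0 M1 M2 eM]] : exists M : int, [/\ l' 0 k0 <= M, l' 1 k1 <= M, l' 2 k2 <= M &
    M = l' 0 k0 \/ M = l' 1 k1 \/ M = l' 2 k2].
  have [|[|]] : (l' 1 k1 <= l' 0 k0 /\ l' 2 k2 <= l' 0 k0) \/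
    (l' 0 k0 <= l' 1 k1 /\ l' 2 k2 <= l' 1 k1) \/
    (l' 0 k0 <= l' 2 k2 /\ l' 1 k1 <= l' 2 k2) by lia.
  - by case=> *; exists (l' 0 k0); split; lia.
  - by case=> *; exists (l' 1 k1); split; lia.
  - by case=> *; exists (l' 2 k2); split; lia.
(* Here [2 u'] exceeds [M] by more than [2 B] and at most [2 B + 2 P = D]; as the upper thresholds
   exceed [M + 2 D], a margin of [2 B] remains on that side too. *)
have [u' [m1 m2 du]] := @ex_congr_gt P (M + 2 * B%:Z) u P_gt0.
have b0 : l' 0 k0 + 2 * B%:Z < 2 * u' /\ 2 * u' + 2 * B%:Z < h' 0 k0 by lia.
have b1 : l' 1 k1 + 2 * B%:Z < 2 * u' /\ 2 * u' + 2 * B%:Z < h' 1 k1 by lia.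
have b2 : l' 2 k2 + 2 * B%:Z < 2 * u' /\ 2 * u' + 2 * B%:Z < h' 2 k2 by lia.
have far (g k : int) : g * x + 2 * k * N < 2 * u - D%:Z ->
    2 * u + D%:Z < g * x + 2 * (k + 1) * N ->
    l' g k + 2 * B%:Z < 2 * u' /\ 2 * u' + 2 * B%:Z < h' g k -> forall j : int,
    near (2 * B) (2 * u - (g * x + 2 * j * N)) (2 * u' - (g * x' + 2 * j * N')).
  rewrite El' Eh' => a1 a2 [a3 a4] j.
  have [jk|jk] : j <= k \/ k + 1 <= j by lia.
    right; left.
    have : 2 * j * N <= 2 * k * N by apply: ler_wpM2r; lia.
    have : 2 * j * N' <= 2 * k * N' by apply: ler_wpM2r; lia.
    lia.
  right; right.
  have : 2 * (k + 1) * N <= 2 * j * N by apply: ler_wpM2r; lia.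
  have : 2 * (k + 1) * N' <= 2 * j * N' by apply: ler_wpM2r; lia.
  lia.
have [dN dx _] := hs.
have dN1 := modeq_mull dN.
have dx1 := modeq_mull dx.
exists u'; split; first split=> //.
- move=> j; move: (far 0 k0 l0 h0 b0 j); clear; rewrite /near -!mulrA; lia.
- split=> //.
    rewrite /modeq; have -> : x - u - (x' - u') = x - x' - (u - u') by ring.
    exact: rpredB.
  move=> j; move: (far 2 k2 l2 h2 b2 (- j)); clear.
  rewrite /near -!mulrA !mulNr; lia.
- move: (far 1 k1 l1 h1 b1 0); clear; rewrite /near; lia.
Qed.

End BackForth.

(** Two applications of [back_forth] with the larger truncation [B + 2 P], whose slack allows one
    image to be moved if both coincide. *)
Lemma back_forth2 (B P E : nat) (N N' x x' u v : int) : (0 < P)%N ->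
  E = (8 * B + 24 * P)%N -> E%:Z < N -> E%:Z < N' ->
  sim E (2 * P) N N' x x' -> u <> v ->
  exists u' v', [/\ u' <> v', rsim B P N N' x x' u u' & rsim B P N N' x x' v v'].
Proof.
move=> P0 eE hN hN' hs uv.
pose D := (2 * (B + 2 * P) + 2 * P)%N.
have eE' : E = (4 * D)%N by rewrite /D; lia.
have [u' hu] := @back_forth (B + 2 * P) P D E N N' x x' P0 erefl eE' hN hN' hs u.
have [v' hv] := @back_forth (B + 2 * P) P D E N N' x x' P0 erefl eE' hN hN' hs v.
have weaken w w' : rsim (B + 2 * P) P N N' x x' w w' -> rsim B P N N' x x' w w'.
  case=> h1 h2 h3; split;
    [apply: (sim_mono _ (dvdnn P) h1); lia|apply: (sim_mono _ (dvdnn P) h2); lia|].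
  by move: h3; clear; rewrite /near; lia.
have [e|ne] := eqVneq u' v'; last first.
  by exists u', v'; split; [apply/eqP | exact: weaken | exact: weaken].
(* One image of two distinct points cannot have both exact distances to a multiple, so it is beyond
   [B + 2 P] from it. A shift by [P] moves [2 v' - x'] by only [2 P], so all comparisons survive at
   [B]. *)
exists u', (v' + P%:Z); split; [by rewrite e; lia | exact: weaken |].
case: hu hv; rewrite {}e => [[dN _ n1] [_ _ n2] n3] [[_ dv m1] [_ dxv m2] m3].
split; first split=> //.
- rewrite /modeq; have -> : v - (v' + P%:Z) = v - v' - P%:Z by ring.
  by rewrite rpredB // dvdzz.
- move=> k; move: (n1 k) (m1 k); clear -uv; rewrite /near; lia.
- split=> //.
    rewrite /modeq; have -> : x - v - (x' - (v' + P%:Z)) = x - v - (x' - v') + P%:Z by ring.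
    by rewrite rpredD // dvdzz.
  move=> k; move: (n2 k) (m2 k); clear -uv; rewrite /near; lia.
- move: n3 m3; clear -uv; rewrite /near; lia.
Qed.

(** * Representations by two terms at least [N] *)

Definition big_rep (f : nat -> bool) (N x u : nat) : bool :=
  [&& N <= u, 2 * u < x, f u & f (x - u)]%N.

Definition nbig_reps (f : nat -> bool) (N x : nat) : nat :=
  #|[pred u : 'I_x | big_rep f N x u]|.

(** Since [u >= N], both summands are below [K * N] when [x < (K + 1) * N]: this is where one block
    is gained. The distances to [0] and [N] give [u' >= 0] and [u' >= N']. *)
Lemma big_rep_transfer K B P N0 (f : nat -> nat -> bool) (N N' x x' u : nat) u' :
  tame K B P N0 f -> (N0 <= N)%N -> (N0 <= N')%N -> (x < K.+1 * N)%N ->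
  big_rep (f N) N x u -> rsim B P N N' x x' u u' ->
  exists n : nat, u' = n /\ big_rep (f N') N' x' n.
Proof.
move=> hf hN hN' hx /and4P[Nu ux fu fxu] [su sxu h].
have [n en] : exists n : nat, u' = n.
  case: su => _ _ /(_ 0); rewrite !mul0r !subr0.
  by case: u' {sxu h} => n; [exists n | rewrite /near; lia].
exists n; split=> //; subst u'.
have N'n : (N' <= n)%N.
  by case: su => _ _ /(_ 1); move: Nu; clear; rewrite /near !mul1r; lia.
have nx : (2 * n < x')%N by move: h ux; clear; rewrite /near; lia.
apply/and4P; split=> //.
- by rewrite -(hf N N' u n) //; rewrite mulSn in hx; lia.
- rewrite -(hf N N' (x - u)%N (x' - n)%N) //; last by rewrite mulSn in hx; lia.
  by rewrite -!subzn //; lia.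
Qed.

Lemma nbig_reps_transfer K B P N0 (f : nat -> nat -> bool) (E N N' x x' : nat) :
  tame K B P N0 f -> (0 < P)%N -> E = (8 * B + 24 * P)%N ->
  (N0 <= N)%N -> (N0 <= N')%N -> (E < N)%N -> (E < N')%N ->
  (x < K.+1 * N)%N -> sim E (2 * P) N N' x x' ->
  (minn 2 (nbig_reps (f N) N x) <= nbig_reps (f N') N' x')%N.
Proof.
move=> hf P0 eE hN hN' EN EN' hx hs.
have tr u u' := @big_rep_transfer _ _ _ _ _ _ _ _ x' u u' hf hN hN' hx.
have lt_x n : big_rep (f N') N' x' n -> (n < x')%N by case/and4P; lia.
case e: (nbig_reps (f N) N x) => [|[|r]] //.
- rewrite minnC /=.
  have [u] : exists u, u \in [pred u : 'I_x | big_rep (f N) N x u].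
    by apply/card_gt0P; rewrite -/(nbig_reps _ _ _) e.
  rewrite inE => hu.
  (* The point [u + 1] is a dummy; only the image of [u] is used. *)
  have uNu : (u : int) <> u%:Z + 1 by lia.
  have [u' [_ [_ ru _]]] := @back_forth2 B P E N N' x x' u (u%:Z + 1) P0 eE
     ltac:(lia) ltac:(lia) hs uNu.
  have [n [_ hn]] := tr _ _ hu ru.
  by apply/card_gt0P; exists (Ordinal (lt_x n hn)); rewrite inE.
- have [u [v [hu hv uv]]] : exists u v, [/\ u \in [pred u : 'I_x | big_rep (f N) N x u],
      v \in [pred u : 'I_x | big_rep (f N) N x u] & u != v].
    by apply/card_gt1P; rewrite -/(nbig_reps _ _ _) e.
  rewrite !inE in hu hv.
  have uv' : (u : int) <> v by move=> [] /val_inj; exact/eqP.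
  have [u' [v' [nuv ru rv]]] := @back_forth2 B P E N N' x x' u v P0 eE
     ltac:(lia) ltac:(lia) hs uv'.
  have [n [en hn]] := tr _ _ hu ru.
  have [m [em hm]] := tr _ _ hv rv.
  apply: leq_trans (geq_minl _ _) _; apply/card_gt1P.
  exists (Ordinal (lt_x n hn)), (Ordinal (lt_x m hm)); split; rewrite ?inE //.
  by apply/eqP => -[nm]; apply: nuv; rewrite en em nm.
Qed.

Lemma sim_lt B P (N N' x x' K : nat) : sim B P N N' x x' ->
  (x < K * N)%N -> (x' < K * N')%N.
Proof.
by case=> _ _ /(_ K); clear; rewrite /near -!PoszM; lia.
Qed.

Lemma tame_nbig_reps K B P N0 (f : nat -> nat -> bool) :
  (0 < P)%N -> tame K B P N0 f ->
  tame K.+1 (8 * B + 24 * P) (2 * P) (N0 + (8 * B + 24 * P).+1)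
    (fun N x => minn 2 (nbig_reps (f N) N x)).
Proof.
move=> P0 hf N N' x x' hN hN' hs hx.
have h := @nbig_reps_transfer _ _ _ _ _ _ N N' x x' hf P0 erefl ltac:(lia)
  ltac:(lia) ltac:(lia) ltac:(lia) hx hs.
have h' := @nbig_reps_transfer _ _ _ _ _ _ N' N x' x hf P0 erefl ltac:(lia)
  ltac:(lia) ltac:(lia) ltac:(lia) (sim_lt hs hx) (sim_sym hs).
lia.
Qed.

(** * A recursion with step [a] on the block [[K N, (K + 1) N)] *)

Section Recursion.

Variables (T : Type) (st : T -> bool -> bool) (K B P N0 a : nat).
Variables (f : nat -> nat -> bool) (t : nat -> nat -> T).
Hypotheses (K_gt0 : (0 < K)%N) (a_gt0 : (0 < a)%N) (P_gt0 : (0 < P)%N).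
Hypothesis a_dvd_P : (a %| P)%N.
Hypothesis tame_f : tame K B P N0 f.
Hypothesis tame_t : tame K.+1 B P N0 t.
Hypothesis f_rec : forall N x, (N0 <= N)%N -> (N <= x)%N ->
  f N x = st (t N x) (f N (x - a)%N).

Let N1 : nat := (N0 + 8 * (B + P + a).+1)%N.

(** Going back by [a] keeps the offsets equal, until the position falls below [K * N], where [f] is
    already tame. *)
Lemma rec_eq_left (N N' j : nat) : (N1 <= N)%N -> (N1 <= N')%N -> modeq P N N' ->
  (j + B < N)%N -> (j + B < N')%N -> f N (K * N + j) = f N' (K * N' + j).
Proof.
move=> hN hN' dN; elim/ltn_ind: j => j IH jN jN'.
have NK : (N <= K * N + j)%N by nia.
have NK' : (N' <= K * N' + j)%N by nia.
rewrite f_rec //; last by rewrite /N1 in hN; lia.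
rewrite [RHS]f_rec //; last by rewrite /N1 in hN'; lia.
congr (st _ _).
  apply: tame_t; try by rewrite /N1 in hN hN'; lia.
  by rewrite !PoszD !PoszM; apply: sim_edge => //; lia.
have [aj|ja] := leqP a j.
  have -> : (K * N + j - a = K * N + (j - a))%N by lia.
  have -> : (K * N' + j - a = K * N' + (j - a))%N by lia.
  by apply: IH; lia.
apply: tame_f; try by rewrite /N1 in hN hN'; lia.
have -> : Posz (K * N + j - a)%N = K%:Z * N%:Z + (j%:Z - a%:Z) by rewrite /N1 in hN; lia.
have -> : Posz (K * N' + j - a)%N = K%:Z * N'%:Z + (j%:Z - a%:Z) by rewrite /N1 in hN'; lia.
by apply: sim_edge=> //; rewrite /N1 in hN hN'; lia.
Qed.

(** As a function of [b], the composite of the [n] steps after [y]; it depends on the inputs [t]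
    alone. *)
Fixpoint run N y n b : bool :=
  if n is m.+1 then st (t N (y + a * n)%N) (run N y m b) else b.

Lemma rec_run N y n : (N1 <= N)%N -> (N <= y)%N -> f N (y + a * n)%N = run N y n (f N y).
Proof.
move=> hN hy; elim: n => [|n IH]; first by rewrite muln0 addn0.
rewrite f_rec /=; try by rewrite /N1 in hN; lia.
by congr (st _ _); rewrite -IH; congr (f _ _); rewrite mulnS; lia.
Qed.

(** A period consists of [P / a] steps, and the inputs are [P]-periodic in the bulk, so the same
    self-map of the booleans acts on three consecutive periods. *)
Lemma rec_period N j : (N1 <= N)%N -> (B < j)%N -> (j + 3 * P + B < N)%N ->
  f N (K * N + j + 3 * P) = f N (K * N + j + P).
Proof.
move=> hN Bj jN; have [p eP] := dvdnP a_dvd_P; rewrite mulnC in eP.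
have NK : (N <= K * N + j)%N by nia.
have runP i n b : (i <= 2)%N -> (n <= p)%N ->
    run N (K * N + j + i * P) n b = run N (K * N + j) n b.
  move=> hi; elim: n => [//|n IH] np /=; rewrite IH; last by lia.
  have anP : (a * n.+1 <= P)%N by rewrite eP leq_mul2l np orbT.
  have iP : (i * P <= 2 * P)%N by rewrite leq_mul2r; lia.
  congr (st _ _); symmetry; apply: tame_t; try by rewrite /N1 in hN; lia.
    rewrite !PoszD -!addrA PoszM; apply: sim_bulk => //; try lia.
      by rewrite /modeq subrr.
    by apply/dvdzP; exists (- i%:Z); rewrite !PoszM; ring.
have F0 := rec_run p hN NK.
have F1 := @rec_run N (K * N + j + 1 * P) p hN ltac:(lia).
have F2 := @rec_run N (K * N + j + 2 * P) p hN ltac:(lia).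
rewrite runP // in F1; rewrite runP // in F2.
rewrite -eP in F0 F1 F2.
have e1 : (K * N + j + 1 * P + P = K * N + j + 2 * P)%N by lia.
have e2 : (K * N + j + 2 * P + P = K * N + j + 3 * P)%N by lia.
rewrite e1 in F1; rewrite e2 in F2; rewrite mul1n in F1.
(* every self-map F of the booleans satisfies F \o F \o F = F *)
rewrite F2 F1 F0; case: (f N (K * N + j)).
  by case E1: (run _ _ _ true); rewrite ?E1 //; case E0: (run _ _ _ false); rewrite ?E1 ?E0.
by case E0: (run _ _ _ false); rewrite ?E0 //; case E1: (run _ _ _ true); rewrite ?E1 ?E0.
Qed.

Lemma rec_periodn N j q : (N1 <= N)%N -> (B + P < j)%N -> (j + 2 * P * q + B < N)%N ->
  f N (K * N + j + 2 * P * q) = f N (K * N + j).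
Proof.
move=> hN Bj; elim: q => [|q IH] jN; first by rewrite muln0 addn0.
rewrite mulnS in jN.
rewrite -IH; last by lia.
(* Starting one period earlier, at [j - P > B], turns the claim into an instance of [rec_period]. *)
have -> : (K * N + j + 2 * P * q = K * N + (j - P + 2 * P * q) + P)%N by lia.
have -> : (K * N + j + 2 * P * q.+1 = K * N + (j - P + 2 * P * q) + 3 * P)%N.
  by rewrite mulnS; lia.
by apply: rec_period; lia.
Qed.

(** The larger offset is brought down to the smaller one by periods [2 * P] within its own block;
    equal offsets are then compared from the left end. *)
Lemma rec_eq_bulk (N N' j j' : nat) : (N1 <= N)%N -> (N1 <= N')%N -> modeq P N N' ->
  modeq (2 * P) j j' -> (B + P < j)%N -> (B + P < j')%N ->
  (j + B < N)%N -> (j' + B < N')%N -> f N (K * N + j) = f N' (K * N' + j').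
Proof.
wlog le_jj' : N N' j j' / (j <= j')%N.
  move=> W; case: (leqP j j') => [|/ltnW] jj' hN hN' dN dj *; first exact: W.
  by symmetry; apply: W => //; rewrite /modeq -opprB rpredN.
move=> hN hN' dN /dvdzP[q eq] Bj Bj' jN jN'.
have [r er] : exists r, j' = (j + 2 * P * r)%N by exists `|q|%N; nia.
rewrite er addnA rec_periodn //; last by rewrite -er.
by apply: rec_eq_left => //; lia.
Qed.

(** Each step back adds [a] to the distance [e] from the right end; once [e > B] the position is in
    the bulk. *)
Lemma rec_eq_right (N N' e : nat) : (N1 <= N)%N -> (N1 <= N')%N ->
  modeq (2 * P) N N' -> (0 < e)%N -> (e <= B + a)%N ->
  f N (K.+1 * N - e) = f N' (K.+1 * N' - e).
Proof.
move=> hN hN' dN; have dN1 : modeq P N N'.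
  exact: modeq_mull dN.
have [n] := ubnP (B + a - e); elim: n e => // n IH e en e0 eB.
have [Be|eB'] := ltnP B e.
  have -> : (K.+1 * N - e = K * N + (N - e))%N by rewrite ?mulSn /N1 in hN *; lia.
  have -> : (K.+1 * N' - e = K * N' + (N' - e))%N by rewrite ?mulSn /N1 in hN' *; lia.
  apply: rec_eq_bulk => //; try by rewrite /N1 in hN hN'; lia.
  rewrite /modeq -!subzn; try by rewrite /N1 in hN hN'; lia.
  by have -> : N%:Z - e%:Z - (N'%:Z - e%:Z) = N%:Z - N'%:Z by ring.
have NK : (N <= K * N)%N by nia.
have NK' : (N' <= K * N')%N by nia.
rewrite f_rec; try by rewrite ?mulSn /N1 in hN *; lia.
rewrite [RHS]f_rec; try by rewrite ?mulSn /N1 in hN' *; lia.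
rewrite -!subnDA; congr (st _ _); last by apply: IH; lia.
apply: tame_t; try by rewrite ?mulSn /N1 in hN hN' *; lia.
have -> : Posz (K.+1 * N - e)%N = K.+1%:Z * N%:Z + - e%:Z.
  by rewrite -PoszM subzn //; rewrite ?mulSn /N1 in hN *; lia.
have -> : Posz (K.+1 * N' - e)%N = K.+1%:Z * N'%:Z + - e%:Z.
  by rewrite -PoszM subzn //; rewrite ?mulSn /N1 in hN' *; lia.
by apply: sim_edge => //; rewrite /N1 in hN hN'; lia.
Qed.

(** On the new block the truncated type fixes the offset near either end, and the residue decides
    elsewhere. The left margin grows to [B + P] because periodicity starts only after one period. *)
Lemma tame_rec : tame K.+1 (B + P) (2 * P) N1 f.
Proof.
move=> N N' x x' hN hN' hs hx.
have [xK|Kx] := ltnP x (K * N).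
  apply: tame_f => //; try by rewrite /N1 in hN hN'; lia.
  by apply: sim_mono hs; [lia | exact: dvdn_mull].
have [dN dx h] := hs.
have dN1 : modeq P N N'.
  exact: modeq_mull dN.
have hx' := sim_lt hs hx.
have Kx' : (K * N' <= x')%N.
  by rewrite leqNgt; apply/negP => /(sim_lt (sim_sym hs)); rewrite ltnNge Kx.
pose j := (x - K * N)%N; pose j' := (x' - K * N')%N.
have ex : x = (K * N + j)%N by rewrite /j; lia.
have ex' : x' = (K * N' + j')%N by rewrite /j'; lia.
have jN : (j < N)%N by rewrite mulSn in hx; lia.
have jN' : (j' < N')%N by rewrite mulSn in hx'; lia.
have n0 : near (B + P) j%:Z j'%:Z.
  have := h K; congr near; rewrite ?ex ?ex' PoszD PoszM; ring.
have n1 : near (B + P) (j%:Z - N%:Z) (j'%:Z - N'%:Z).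
  have := h K.+1; congr near; rewrite ?ex ?ex' PoszD PoszM -addn1 PoszD; ring.
have dj : modeq (2 * P) j j'.
  rewrite /modeq; have -> : j%:Z - j'%:Z = x%:Z - x'%:Z - K%:Z * (N%:Z - N'%:Z).
    by rewrite ex ex' !PoszD !PoszM; ring.
  by apply: rpredB => //; exact: dvdz_mull.
have [c|c] : ((N - j <= B) \/ (N' - j' <= B))%N \/
    ((B + j < N)%N /\ (B + j' < N')%N) by lia.
  have e : (N - j = N' - j')%N by move: n1 c jN jN'; clear; rewrite /near; lia.
  have -> : x = (K.+1 * N - (N - j))%N by rewrite mulSn; lia.
  have -> : x' = (K.+1 * N' - (N - j))%N by rewrite mulSn; lia.
  by apply: rec_eq_right => //; lia.
rewrite ex ex'.
have [c'|c'] : ((j <= B + P) \/ (j' <= B + P))%N \/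
    ((B + P < j)%N /\ (B + P < j')%N) by lia.
  have e : j = j' by move: n0 c'; clear; rewrite /near; lia.
  by rewrite -e; apply: rec_eq_left => //; rewrite -?e in c *; lia.
by apply: rec_eq_bulk => //; lia.
Qed.

End Recursion.

(** * Ulam sequences: membership and its recursion *)

(** Stage [x] suffices, since the term of index [k] is at least [k]. *)
Definition inU (a b x : nat) : bool := x \in ulam_terms a b x.

Section UlamBasics.

Local Open Scope nat_scope.

Variables (a b : nat).
Hypotheses (a_gt0 : 0 < a) (ab : a < b).

Lemma size_ulam_terms n : size (ulam_terms a b n) = n.+2.
Proof. by elim: n => //= n; rewrite size_rcons => ->. Qed.

Lemma ulam_terms_sorted n : sorted ltn (ulam_terms a b n).
Proof. by have [|t [x [y [-> _]]]] := @ulam_terms_inv a b n; rewrite ?a_gt0. Qed.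

Lemma nth_ulam_termsD n d k : k < n.+2 ->
  nth 0 (ulam_terms a b (d + n)) k = nth 0 (ulam_terms a b n) k.
Proof.
move=> kn; elim: d => // d IH; rewrite addSn /= nth_rcons size_ulam_terms.
by rewrite (leq_trans kn) // !ltnS leq_addl.
Qed.

Lemma nth_ulam_terms n k : k < n.+2 -> nth 0 (ulam_terms a b n) k = ulam a b k.
Proof.
rewrite ltnS leq_eqVlt => /orP[/eqP ->|kn].
  by rewrite /ulam -(@nth_ulam_termsD n 1).
by rewrite ltnS in kn; rewrite -(subnK kn) nth_ulam_termsD // ltnW.
Qed.

Lemma ulam_ltS n : ulam a b n < ulam a b n.+1.
Proof.
rewrite -(@nth_ulam_terms n n) // -(@nth_ulam_terms n n.+1) //.
by apply: (sorted_ltn_nth ltn_trans 0 (ulam_terms_sorted n));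
  rewrite ?inE ?size_ulam_terms.
Qed.

Lemma ulam_mono : {mono ulam a b : i j / i <= j}.
Proof. by apply: leq_mono; apply: homo_ltn ulam_ltS; exact: ltn_trans. Qed.

Lemma ulam_lt_mono : {mono ulam a b : i j / i < j}.
Proof. exact: leqW_mono ulam_mono. Qed.

Lemma ulam_ge n : n <= ulam a b n.
Proof. by elim: n => // n IH; exact: leq_ltn_trans (ulam_ltS n). Qed.

Lemma mem_ulam_terms n x :
  reflect (exists2 k, k < n.+2 & ulam a b k = x) (x \in ulam_terms a b n).
Proof.
apply: (iffP (nthP 0)); rewrite size_ulam_terms => -[k kn <-]; exists k => //;
  by rewrite nth_ulam_terms.
Qed.

Lemma inUP x : reflect (in_ulam a b x) (inU a b x).
Proof.
apply: (iffP (mem_ulam_terms _ _)) => [[k _ <-]|[k <-]]; first by exists k.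
by exists k => //; rewrite !ltnS leqW // ulam_ge.
Qed.

Lemma inU_lt x : x < b -> inU a b x = (x == a).
Proof.
move=> xb; apply/inUP/eqP => [[[|n] e]|->]; [by rewrite -e | | by exists 0].
have : b <= x by rewrite -e -[b]/(ulam a b 1) ulam_mono.
by rewrite leqNgt xb.
Qed.

Lemma inU_b : inU a b b.
Proof. by apply/inUP; exists 1. Qed.

Lemma ulam_bracket x : b < x -> exists n, ulam a b n.+1 < x <= ulam a b n.+2.
Proof.
move=> bx; have ex : exists n, x <= ulam a b n.+2.
  by exists x; apply: leq_trans (ulam_ge _) _; rewrite ulam_mono leqW.
case: (ex_minnP ex) => -[|n] hn min; first by exists 0; rewrite bx.
by exists n.+1; rewrite hn andbT ltnNge; apply/negP => /min; rewrite ltnn.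
Qed.

Lemma ulam_next_terms n : ulam_next (ulam_terms a b n) = ulam a b n.+2.
Proof.
rewrite -(@nth_ulam_terms n.+1) // [ulam_terms a b n.+1]iterS nth_rcons.
by rewrite -/(ulam_terms a b n) size_ulam_terms ltnn eqxx.
Qed.

(** The list [w] is the stage holding exactly the terms below [x]; by minimality of the next term,
    [x] is a term if and only if it is uniquely represented there. *)
Lemma inU_nreps x : b < x -> exists w, [/\ uniq w,
  forall y, y < x -> (y \in w) = inU a b y, forall y, y \in w -> y < x &
  inU a b x = (nreps w x == 1)].
Proof.
move=> bx; have [n /andP[nx xn]] := ulam_bracket bx.
have mem_lt y : y \in ulam_terms a b n -> y < x.
  by case/mem_ulam_terms=> k kn <-; apply: leq_ltn_trans nx; rewrite ulam_mono.
exists (ulam_terms a b n); split=> //.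
- exact: (sorted_uniq ltn_trans ltnn (ulam_terms_sorted n)).
- move=> y yx; apply/mem_ulam_terms/inUP => [[k _ <-]|[k ek]].
    by exists k.
  by exists k => //; rewrite -ulam_lt_mono ek (leq_trans yx).
have [|t [y [z [e y0 st]]]] := @ulam_terms_inv a b n; first by rewrite a_gt0.
have [_] := ulam_nextP y0 st; rewrite -e ulam_next_terms => r1 min.
have ez : z = ulam a b n.+1.
  rewrite -(@nth_ulam_terms n) // -[n.+1]/(n.+2.-1) -(size_ulam_terms n).
  by rewrite nth_last e last_rcons.
apply/inUP/eqP => [[k ek]|r].
  suff ekn : k = n.+2 by rewrite -ek ekn; exact: r1.
  apply/eqP; rewrite eqn_leq -(ulam_mono k) ek xn /=.
  by rewrite -(ulam_lt_mono n.+1) ek.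
exists n.+2; apply/eqP; rewrite eqn_leq xn andbT; apply: min => //.
by rewrite ez.
Qed.

(** Representations are counted by their smaller summand, which is either [a] or at least [b]. *)
Lemma nreps_split x w : 2 * a < b -> b < x -> uniq w ->
  (forall y, y < x -> (y \in w) = inU a b y) -> (forall y, y \in w -> y < x) ->
  nreps w x = inU a b (x - a) + nbig_reps (inU a b) b x.
Proof.
move=> ab2 bx uw mw ltw.
pose F := [seq uv <- [seq (u, v) | u <- w, v <- w] |
  (uv.1 < uv.2) && (uv.1 + uv.2 == x)].
pose G := nseq (inU a b (x - a)) a ++
  map val (enum [pred u : 'I_x | big_rep (inU a b) b x u]).
have -> : inU a b (x - a) + nbig_reps (inU a b) b x = size G.
  by rewrite size_cat size_nseq size_map -cardE.
have -> : nreps w x = size (map fst F) by rewrite size_map size_filter.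
have mG y : (y \in G) = [&& 2 * y < x, inU a b y & inU a b (x - y)].
  rewrite mem_cat mem_nseq.
  have -> : (y \in map val (enum [pred u : 'I_x | big_rep (inU a b) b x u])) =
      big_rep (inU a b) b x y.
    apply/mapP/idP => [[u]|yb]; first by rewrite mem_enum inE => ? ->.
    have yx : y < x by case/and4P: yb; lia.
    by exists (Ordinal yx); rewrite ?mem_enum.
  rewrite /big_rep; have [yb|yb] := ltnP y b.
    rewrite (inU_lt yb) /=; have [->|_] := eqVneq y a; last by rewrite !andbF.
    by rewrite lt0b andbT orbF; have -> : 2 * a < x by lia.
  have -> : (y == a) = false by lia.
  by rewrite andbF.
apply/perm_size/uniq_perm.
- rewrite map_inj_in_uniq; last first.
    move=> [u v] [u' v']; rewrite !mem_filter /=.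
    by move=> /andP[/andP[_ /eqP e] _] /andP[/andP[_ /eqP e'] _] uu'; congr (_, _); lia.
  by apply/filter_uniq/allpairs_uniq => // -[? ?] [? ?].
- rewrite cat_uniq (map_inj_uniq val_inj) enum_uniq andbT.
  apply/andP; split; first by case: (inU a b _).
  apply/hasPn => y /mapP[u]; rewrite mem_enum inE => /and4P[bu _ _ _] -> /=.
  by rewrite mem_nseq; apply/negP => /andP[_ /eqP]; lia.
move=> y; rewrite mG; apply/mapP/and3P => [[[u v]]|[yx Uy Uxy]].
  rewrite mem_filter /= => /andP[/andP[uv /eqP e] /allpairsP[[u' v'] /=]].
  move=> [uw' vw' [eu ev]] ->; subst u' v'.
  have -> : x - u = v by lia.
  by split; [lia | rewrite -mw // ltw | rewrite -mw // ltw].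
exists (y, x - y) => //; rewrite mem_filter /=; apply/andP; split; first by lia.
apply/allpairsP; exists (y, x - y) => /=.
(* Since [0] is not a term, [x - y < x], so membership in [w] applies to it. *)
have y0 : 0 < y by move: Uy; case: y {yx Uxy} => //; rewrite inU_lt; lia.
by split=> //; rewrite mw //; lia.
Qed.

Lemma inU_rec x : 2 * a < b -> b < x ->
  inU a b x = (inU a b (x - a) + nbig_reps (inU a b) b x == 1).
Proof.
move=> ab2 bx; have [w [uw mw ltw ->]] := inU_nreps bx.
by rewrite (nreps_split ab2 bx uw).
Qed.

End UlamBasics.

(* The value 1 at x = N makes the recursion produce the initial term N, since
   N - a is not a term. *)
Definition step_code (a N x : nat) : nat :=
  if x == N then 1%N else minn 2 (nbig_reps (inU a N) N x).

Lemma inU_step a N x : (0 < a)%N -> (2 * a < N)%N -> (N <= x)%N ->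
  inU a N x = (inU a N (x - a) + step_code a N x == 1)%N.
Proof.
move=> a0 aN; rewrite leq_eqVlt /step_code => /orP[/eqP <-|Nx].
  have aN' : (a < N)%N by lia.
  have lt : (N - a < N)%N by lia.
  by rewrite eqxx inU_b // inU_lt //; lia.
have -> : (x == N) = false by lia.
by rewrite [LHS]inU_rec //; lia.
Qed.

(** * Tameness of the Ulam sequence, block by block *)

Lemma tame_step_code a K B P N0 : (0 < P)%N -> tame K B P N0 (inU a) ->
  tame K.+1 (8 * B + 24 * P) (2 * P) (N0 + (8 * B + 24 * P).+1) (step_code a).
Proof.
move=> P0 hU N N' x x' hN hN' hs hx; rewrite /step_code.
have -> : (x == N) = (x' == N').
  by case: hs => _ _ /(_ 1); clear; rewrite /near !mul1r; lia.
by rewrite (tame_nbig_reps P0 hU hN hN' hs hx).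
Qed.

Lemma tame_inU a K : (0 < a)%N ->
  exists B P N0, (0 < P)%N /\ tame K.+1 B P N0 (inU a).
Proof.
move=> a0; elim: K => [|K [B [P [N0 [P0 hU]]]]].
  (* On [[0, N)] the only term is [a], and the distance to [0] truncated at [B = a] still tells
     whether it equals [a]. *)
  exists a, 1%N, a.+1; split=> // N N' x x' hN hN' hs xN.
  have xN' := sim_lt hs xN; rewrite !mul1n in xN xN'.
  rewrite !inU_lt //; case: hs => _ _ /(_ 0); clear; rewrite /near !mul0r; lia.
(* These are the constants of [tame_step_code], with a factor [a] added to the period so that the
   step of the recursion divides it. *)
pose B1 := (8 * B + 24 * P)%N; pose P1 := (a * (2 * P))%N.
pose N1 := (N0 + B1.+1 + 2 * a)%N.
have hU1 : tame K.+1 B1 P1 N1 (inU a).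
  by apply: tame_mono hU; rewrite /B1 /P1 /N1 ?mulnA ?dvdn_mull //; lia.
have ht1 : tame K.+2 B1 P1 N1 (step_code a).
  apply: tame_mono (tame_step_code P0 hU);
    [exact: leqnn | exact: dvdn_mull | by rewrite /N1 /B1; lia].
have P1_gt0 : (0 < P1)%N by rewrite !muln_gt0 a0.
exists (B1 + P1)%N, (2 * P1)%N, (N1 + 8 * (B1 + P1 + a).+1)%N.
split; first by rewrite muln_gt0.
apply: (@tame_rec nat (fun t (b : bool) => b + t == 1)%N _ _ _ _ a _ (step_code a)) => //.
- exact: dvdn_mulr.
- by move=> N x hN Nx; apply: inU_step => //; rewrite /N1 in hN; lia.
Qed.

(** * From tameness to periodic pieces *)

Lemma modn_modeq (L N c : nat) : N = c %[mod L] -> modeq L N c.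
Proof.
move=> e; apply/dvdzP; exists ((N %/ L)%N%:Z - (c %/ L)%N%:Z).
rewrite {1}(divn_eq N L) {1}(divn_eq c L) e !PoszD !PoszM; ring.
Qed.

Section Pieces.

Variables (f : nat -> nat -> bool) (C B P N0 c : nat).
Hypothesis tame_f : tame C.+1 B P N0 f.
Hypotheses (P_gt1 : (1 < P)%N) (N0_ge : (4 * B + 2 * P + 4 <= N0)%N).

Let W : nat := (2 * B + 1)%N.
Let M : nat := (c + P * N0)%N.

(* Pieces of length 1 are the points k N + e with k <= C and |e| <= B, listed
   by i = k W + (e + B); the i-th piece of length P is ]i N + B, (i + 1) N - B[,
   with its pattern read off the representative M of the class of c. *)
Definition piece_m (l i : nat) : int := if l == 1%N then (i %/ W)%N else i.
Definition piece_p (l i : nat) : int :=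
  if l == 1%N then (i %% W)%N%:Z - B%:Z else B%:Z + 1.
Definition piece_k (l i : nat) : int := if l == 1%N then (i %/ W)%N else i.+1.
Definition piece_r (l i : nat) : int :=
  if l == 1%N then (i %% W)%N%:Z - B%:Z else - (B%:Z + 1).
Definition piece_s (l i : nat) : l.-tuple bool :=
  [tuple of mkseq (fun t => f M `|(piece_m l i * M%:Z + piece_p l i + t%:Z)%R|%N) l].
Definition piece_q (l : nat) : nat :=
  if l == 1%N then (C.+1 * W)%N else if l == P then C else 0%N.

Definition piece (N l i : nat) : pred nat :=
  periodicA (piece_m l i * N%:Z + piece_p l i) (piece_k l i * N%:Z + piece_r l i)
            (piece_s l i).

Lemma W_gt0 : (0 < W)%N. Proof. by rewrite /W addn1. Qed.

Lemma M_ge : (N0 <= M)%N.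
Proof. by rewrite /M; apply: leq_trans (leq_addl _ _); rewrite leq_pmull // ltnW. Qed.

Lemma piece_q_cases l i : (0 < l)%N -> (i < piece_q l)%N ->
  l = 1%N /\ (i %/ W <= C)%N \/ l = P /\ (i < C)%N.
Proof.
move=> l0; rewrite /piece_q; case: eqP => [->|_].
  by left; rewrite -ltnS ltn_divLR ?W_gt0.
by case: eqP => [->|_] //; right.
Qed.

Lemma modeq_M N : N = c %[mod P] -> modeq P N M.
Proof.
move/modn_modeq => Nc; rewrite /modeq /M.
have -> : N%:Z - Posz (c + P * N0) = (N%:Z - c%:Z) - P%:Z * N0%:Z.
  by rewrite PoszD PoszM; ring.
by apply: rpredB => //; exact: dvdz_mulr.
Qed.

(** The pattern is read at a position for [M] of the same type as [n]: the same offset from a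
    multiple if [l = 1], a congruent bulk position if [l = P]. *)
Lemma pieceE N l i n : (N0 <= N)%N -> N = c %[mod P] ->
  (0 < l)%N -> (i < piece_q l)%N ->
  piece_m l i * N%:Z + piece_p l i <= n%:Z <= piece_k l i * N%:Z + piece_r l i ->
  piece N l i n = f N n.
Proof.
move=> hN /modeq_M NM l0 iq /andP[h1 h2].
rewrite /piece /periodicA h1 h2 /=; have hM := M_ge.
set d := n%:Z - _; have d0 : 0 <= d by rewrite /d; lia.
have t0 : 0 <= (d %% l)%Z by apply: modz_ge0; lia.
have t1 : (d %% l)%Z < l by apply: ltz_pmod; lia.
have et := divz_eq d l; set t := (d %% l)%Z in t0 t1 et *.
rewrite nth_mkseq; last by lia.
rewrite gez0_abs //; symmetry.
have en : n%:Z = piece_m l i * N%:Z + piece_p l i + d by rewrite /d; ring.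
case: (piece_q_cases l0 iq) => [[el iC]|[el iC]].
  subst l; rewrite /piece_m /piece_p /piece_k /piece_r /= in en h1 h2 *.
  have lt := ltn_pmod i W_gt0; rewrite {2}/W in lt.
  set u := (i %/ W)%N in en h1 h2 iC *; set v := (i %% W)%N in lt en h1 h2 *.
  have td : t = 0 by lia.
  have d00 : d = 0 by lia.
  rewrite d00 addr0 in en; rewrite td addr0.
  (* The absolute value in [piece_s] is harmless: for [u = 0] this position is [n] itself, otherwise
     [M] exceeds [B]. *)
  have uM : 0 <= u%:Z * M%:Z + (v%:Z - B%:Z).
    case: u {h1 h2 iC} en => [|u] en; first by rewrite mul0r in en *; lia.
    have : M%:Z <= u.+1%:Z * M%:Z by rewrite -PoszM lez_nat leq_pmull.
    lia.
  apply: (tame_f hN hM).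
    by rewrite en gez0_abs //; apply: sim_edge => //; lia.
  have : (u * N <= C * N)%N by rewrite leq_mul2r iC orbT.
  by rewrite -PoszM in en; rewrite mulSn; lia.
subst l; rewrite /piece_m /piece_p /piece_k /piece_r in en h1 h2 *.
have Pn1 : (P == 1%N) = false by lia.
rewrite Pn1 in en h1 h2 *; rewrite -addn1 PoszD mulrDl mul1r in h2.
have iM : 0 <= i%:Z * M%:Z by rewrite -PoszM.
apply: (tame_f hN hM).
  rewrite en gez0_abs; last by lia.
  rewrite -!(addrA (_ * _)); apply: sim_bulk => //; try lia.
  apply/dvdzP; exists (d %/ P)%Z; rewrite {1}et; ring.
have : (i.+1 * N <= C * N)%N by rewrite leq_mul2r iC orbT.
rewrite -PoszM in h2; rewrite !mulSn; lia.
Qed.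

(** Ends of pieces are within [B + 1] of multiples of [N], and [N > 2 (B + 1)], so comparing ends
    compares the multiples. *)
Lemma piece_disjoint N l i j n : (N0 <= N)%N -> (0 < l)%N ->
  (i < piece_q l)%N -> (j < piece_q l)%N -> piece N l i n -> piece N l j n -> i = j.
Proof.
move=> hN l0 iq jq /and3P[i1 i2 _] /and3P[j1 j2 _].
have key (x y e e' : int) : x * N%:Z + e <= y * N%:Z + e' ->
    `|e| <= B%:Z + 1 -> `|e'| <= B%:Z + 1 -> x <= y.
  move=> h he he'; rewrite leNgt; apply/negP => yx.
  have : (y + 1) * N%:Z <= x * N%:Z by apply: ler_wpM2r; lia.
  rewrite mulrDl mul1r; lia.
case: (piece_q_cases l0 iq) => [[el iC]|[el iC]]; subst l;
  rewrite /piece_m /piece_p /piece_k /piece_r /= in i1 i2 j1 j2.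
  have lti := ltn_pmod i W_gt0; have ltj := ltn_pmod j W_gt0.
  rewrite {2}/W in lti; rewrite {2}/W in ltj.
  have ij : (i %/ W)%N%:Z <= (j %/ W)%N%:Z.
    by apply: key (le_trans i1 j2) _ _; lia.
  have ji : (j %/ W)%N%:Z <= (i %/ W)%N%:Z.
    by apply: key (le_trans j1 i2) _ _; lia.
  have e : (i %/ W = j %/ W)%N by lia.
  rewrite e in i1 i2; rewrite (divn_eq i W) (divn_eq j W) e; congr (_ + _)%N; lia.
have Pn1 : (P == 1%N) = false by lia.
rewrite Pn1 in i1 i2 j1 j2.
have lt_key (x y : nat) : x%:Z * N%:Z + (B%:Z + 1) <= y.+1%:Z * N%:Z + - (B%:Z + 1) ->
    (x <= y)%N.
  move=> h; rewrite -ltnS ltnNge; apply/negP => yx.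
  have : y.+1%:Z * N%:Z <= x%:Z * N%:Z by apply: ler_wpM2r; lia.
  lia.
have := lt_key _ _ (le_trans i1 j2); have := lt_key _ _ (le_trans j1 i2); lia.
Qed.

Lemma piece_cover N n : (N0 <= N)%N -> (n <= C * N)%N ->
  exists l i, [/\ (0 < l)%N, (i < piece_q l)%N &
   piece_m l i * N%:Z + piece_p l i <= n%:Z <= piece_k l i * N%:Z + piece_r l i].
Proof.
clear M c; move=> hN nC.
have point (u : nat) (e : int) : (u <= C)%N -> `|e| <= B%:Z -> n%:Z = u%:Z * N%:Z + e ->
  exists l i, [/\ (0 < l)%N, (i < piece_q l)%N &
   piece_m l i * N%:Z + piece_p l i <= n%:Z <= piece_k l i * N%:Z + piece_r l i].
  move=> uC he en; pose v := `|(e + B%:Z)%R|%N.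
  have vW : (v < W)%N by rewrite /v /W; lia.
  exists 1%N, (u * W + v)%N; rewrite /piece_q /piece_m /piece_p /piece_k /piece_r /=.
  rewrite divnMDl ?W_gt0 // modnMDl divn_small // modn_small // addn0; split=> //.
    apply: (@leq_trans (u.+1 * W)); first by rewrite mulSn addnC ltn_add2r.
    by rewrite leq_mul2r ltnS uC orbT.
  by rewrite en /v; lia.
have N_gt0 : (0 < N)%N by lia.
have eN := divn_eq n N; set u := (n %/ N)%N in eN; set j := (n %% N)%N in eN.
have jN : (j < N)%N by rewrite ltn_pmod.
have uC : (u <= C)%N by rewrite /u -(mulnK C N_gt0) leq_div2r.
have [jB|Bj] := leqP j B.
  by apply: (point u j%:Z) => //; rewrite -?PoszM; lia.
(* For [u = C] the bound [n <= C * N] would force [j = 0], contrary to [B < j]. *)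
have uC' : (u < C)%N.
  rewrite ltn_neqAle uC andbT; apply/eqP => uE; rewrite uE in eN; lia.
have [jB'|Bj'] := leqP (N - j) B.
  apply: (point u.+1 (j%:Z - N%:Z)) => //; first by lia.
  by rewrite -PoszM mulSn; lia.
exists P, u; have Pn1 : (P == 1%N) = false by lia.
rewrite /piece_q /piece_m /piece_p /piece_k /piece_r Pn1 eqxx; split=> //; first by lia.
by rewrite -!PoszM mulSn; lia.
Qed.

End Pieces.

Local Close Scope ring_scope.

Theorem theorem2p4 (a C : nat) (ha : 0 < a) (hC : 0 < C) :
  exists L N0 : nat, [/\ 0 < L, 0 < N0 &
  forall c : 'I_L,
  exists (lmax : nat) (q : nat -> nat) (m p k r : nat -> nat -> int)
         (s : forall l : nat, nat -> l.-tuple bool),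
  [/\ forall l, lmax < l -> q l = 0,
      forall l i, 0 < l -> i < q l -> (m l i = k l i <-> l = 1) &
      forall N : nat, N0 <= N -> a < N -> N = c %[mod L] ->
        let A l i := periodicA (m l i * N%:Z + p l i)%R
                               (k l i * N%:Z + r l i)%R (s l i) in
        (forall l i j n, 0 < l -> i < q l -> j < q l -> i <> j ->
           ~ (A l i n /\ A l j n)) /\
        (forall n, (in_ulam a N n /\ 1 <= n <= C * N) <->
           ((exists l i, [/\ 0 < l, i < q l & A l i n]) /\
            1 <= n <= C * N))]].
Proof.
(* Tameness is taken on [C + 1] blocks because the point pieces reach [C * N + B]. *)
have [B [P0 [N0 [P0_gt0 tU0]]]] := tame_inU C ha.
(* Doubling ensures [P > 1], so that bulk pieces never have length 1. The same [P] serves as modulus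
   [L] and as [lmax]. *)
pose P := 2 * P0; pose N1 := N0 + 4 * B + 2 * P + 4.
have tU : tame C.+1 B P N1 (inU a).
  apply: tame_mono tU0; [exact: leqnn | exact: dvdn_mull | by rewrite /N1; lia].
have P_gt1 : 1 < P by rewrite /P; lia.
have N1_ge : 4 * B + 2 * P + 4 <= N1 by rewrite /N1; lia.
exists P, N1; split; [lia | lia | move=> c].
exists P, (piece_q C B P), (piece_m B), (piece_p B), (piece_k B), (piece_r B),
  (piece_s (inU a) B P N1 c); split.
- move=> l Pl; rewrite /piece_q; case: eqP => [|_]; first by lia.
  by case: eqP => // eP; lia.
- move=> l i _ _; rewrite /piece_m /piece_k; case: eqP => [->|ne] //.
  by split=> // -[e]; lia.
move=> N hN aN Nc A; split=> [l i j n l0 iq jq ij [Ai Aj]|n].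
  exact: ij (piece_disjoint P_gt1 N1_ge hN l0 iq jq Ai Aj).
split=> -[h n_bd]; split=> //.
  have [l [i [l0 iq hn]]] := piece_cover P_gt1 N1_ge hN (proj2 (andP n_bd)).
  exists l, i; split=> //.
  by rewrite -[A l i n]/(piece _ _ _ _ _ N l i n) (pieceE tU) //; apply/(inUP ha aN).
have [l [i [l0 iq Ai]]] := h; apply/(inUP ha aN).
have /and3P[h1 h2 _] := Ai.
by rewrite -(pieceE tU P_gt1 N1_ge hN Nc l0 iq (introT andP (conj h1 h2))).
Qed.
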